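(* Let $a,b\in\mathbb N^q$ and $c,d\in\mathbb N^s$ be row vectors, and let $n\ge\max(2,q+s)$. Define, for a two-row matrix $\begin{pmatrix}x\\ y\end{pmatrix}$ with row sums $X,Y$, $$F_n\begin{pmatrix}x\\ y\end{pmatrix}=\frac{(X+n-2)!!\,(Y+n-2)!!}{(n-2)!!\,(X+Y+n-2)!!}\,J_n\begin{pmatrix}x\\ y\end{pmatrix}.$$ Then $$F_n\begin{pmatrix}a&c\\ b&d\end{pmatrix}=F_n\begin{pmatrix}a&d\\ b&c\end{pmatrix}.$$
   Context: For an integer $m\ge0$, $m!!$ denotes $(m-1)(m-3)\cdots$, the product of positive integers $\le m-1$ with the parity of $m-1$ (empty product $=1$). $O_n$ is the orthogonal group with Haar probability measure; for $a\in M_{p\times q}(\mathbb N)$, $p,q\le n$, $I_n(a)=\int_{O_n}\prod_{i,j}u_{ij}^{a_{ij}}\,du$, and $J_n(a)$ is defined by $I_n(a)=\frac{(n-1)!!\prod_{i,j}a_{ij}!!}{(\sum_{i,j}a_{ij}+n-1)!!}J_n(a)$. *)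

(* Defs.v *)
From HB Require Import structures.
From mathcomp Require Import all_boot all_order all_algebra.
From mathcomp Require Import all_classical all_reals all_analysis.

Set Implicit Arguments.
Unset Strict Implicit.
Unset Printing Implicit Defensive.

Import Order.TTheory GRing.Theory Num.Theory.
Import numFieldNormedType.Exports.

Local Open Scope classical_set_scope.
Local Open Scope ring_scope.

Record orthogonal (R : realType) (n : nat) := Orthogonal {
  orthogonal_mx :> 'M[R]_n;
  orthogonal_mxP : orthogonal_mx *m orthogonal_mx^T == 1%:M
}.

HB.instance Definition _ (R : realType) (n : nat) :=
  [isSub for @orthogonal_mx R n].
HB.instance Definition _ (R : realType) (n : nat) :=
  [Choice of orthogonal R n by <:].

Section OrthogonalGroup.
Variables (R : realType) (n : nat).
Implicit Types u v : orthogonal R n.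

Lemma orthogonal_oneP : (1%:M : 'M[R]_n) *m 1%:M^T == 1%:M.
Proof. by rewrite trmx1 mulmx1. Qed.

Lemma orthogonal_mulP u v : (u *m v) *m (u *m v)^T == 1%:M.
Proof.
rewrite trmx_mul mulmxA -(mulmxA u) (eqP (orthogonal_mxP v)) mulmx1.
exact: orthogonal_mxP.
Qed.

Lemma orthogonal_invP u : u^T *m u^T^T == 1%:M.
Proof. by rewrite trmxK (mulmx1C (eqP (orthogonal_mxP u))). Qed.

Definition orthogonal_one : orthogonal R n := Orthogonal orthogonal_oneP.
Definition orthogonal_mul u v : orthogonal R n :=
  Orthogonal (orthogonal_mulP u v).
Definition orthogonal_inv u : orthogonal R n :=
  Orthogonal (orthogonal_invP u).

Lemma orthogonal_mulA : associative orthogonal_mul.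
Proof. by move=> u v w; apply: val_inj; rewrite /= mulmxA. Qed.
Lemma orthogonal_mul1 : left_id orthogonal_one orthogonal_mul.
Proof. by move=> u; apply: val_inj; rewrite /= mul1mx. Qed.
Lemma orthogonal_mulr1 : right_id orthogonal_one orthogonal_mul.
Proof. by move=> u; apply: val_inj; rewrite /= mulmx1. Qed.
Lemma orthogonal_mulV : left_inverse orthogonal_one orthogonal_inv orthogonal_mul.
Proof.
by move=> u; apply: val_inj; rewrite /= (mulmx1C (eqP (orthogonal_mxP u))).
Qed.
Lemma orthogonal_mulrV :
  right_inverse orthogonal_one orthogonal_inv orthogonal_mul.
Proof. by move=> u; apply: val_inj; rewrite /= (eqP (orthogonal_mxP u)). Qed.

HB.instance Definition _ := isGroup.Build (orthogonal R n)
  orthogonal_mulA orthogonal_mul1 orthogonal_mulr1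
  orthogonal_mulV orthogonal_mulrV.
HB.instance Definition _ := isPointed.Build (orthogonal R n) orthogonal_one.
HB.instance Definition _ := Topological.copy (orthogonal R n)
  (initial_topology (@orthogonal_mx R n)).

End OrthogonalGroup.

Notation orthogonal_borel R n :=
  (g_sigma_algebraType (@open (orthogonal R n))).

(* The library has no Haar measure. On a compact group, left invariance
   determines a Borel probability measure uniquely (and entails right
   invariance). *)
Definition is_haar (R : realType) (n : nat)
    (mu : probability (orthogonal_borel R n) R) : Prop :=
  forall (g : orthogonal R n) (A : set (orthogonal_borel R n)),
    measurable A -> mu [set (g * u)%g | u in A] = mu A.

(* [dfact m] is m!! = (m - 1)(m - 3)..., shifted by one from the usual double
   factorial; dfact 0 = dfact 1 = 1. *)
Definition dfact (m : nat) : nat :=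
  \prod_(1 <= k < m | odd k == odd m.+1) k.

Lemma dfact_gt0 (m : nat) : (0 < dfact m)%N.
Proof.
rewrite /dfact big_seq_cond; apply: prodn_cond_gt0 => k.
by rewrite mem_index_iota => /andP[/andP[]].
Qed.

Section PolynomialIntegrals.
Variables (R : realType) (n : nat) (mu : probability (orthogonal_borel R n) R).

(* A p x q matrix of exponents is placed in the upper left corner of u. *)
Definition I_int (p q : nat) (hp : (p <= n)%N) (hq : (q <= n)%N)
    (a : 'M[nat]_(p, q)) : R :=
  \int[mu]_u \prod_(i < p) \prod_(j < q)
    orthogonal_mx u (widen_ord hp i) (widen_ord hq j) ^+ a i j.

Definition J_int (p q : nat) (hp : (p <= n)%N) (hq : (q <= n)%N)
    (a : 'M[nat]_(p, q)) : R :=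
  I_int hp hq a /
  ((dfact (n - 1) * \prod_(i < p) \prod_(j < q) dfact (a i j))%:R /
   (dfact (\sum_(i < p) \sum_(j < q) a i j + n - 1))%:R).

Lemma I_intE (p q : nat) (hp : (p <= n)%N) (hq : (q <= n)%N)
    (a : 'M[nat]_(p, q)) :
  I_int hp hq a =
  (dfact (n - 1) * \prod_(i < p) \prod_(j < q) dfact (a i j))%:R /
  (dfact (\sum_(i < p) \sum_(j < q) a i j + n - 1))%:R * J_int hp hq a.
Proof.
rewrite mulrC divfK// mulf_neq0// ?invr_eq0 pnatr_eq0 -lt0n ?dfact_gt0//.
rewrite muln_gt0 dfact_gt0 prodn_gt0// => i.
by apply: prodn_gt0 => j; exact: dfact_gt0.
Qed.

Definition F_int (q : nat) (h2 : (2 <= n)%N) (hq : (q <= n)%N)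
    (z : 'M[nat]_(2, q)) : R :=
  let X := (\sum_(j < q) z 0%R j)%N in
  let Y := (\sum_(j < q) z 1%R j)%N in
  (dfact (X + n - 2) * dfact (Y + n - 2))%:R /
  (dfact (n - 2) * dfact (X + Y + n - 2))%:R * J_int h2 hq z.

End PolynomialIntegrals.

(* Main.v *)
Require Import Defs.
From mathcomp Require Import all_boot all_order all_algebra.
From mathcomp Require Import all_classical all_reals all_analysis.
From mathcomp Require Import measurable_realfun.
From mathcomp Require Import zify ring lra.

(* Write M(x; y) for the integral of prod_j u_1j^x_j u_2j^y_j, with row sums X, Y.
   Differentiating the invariance of the Haar measure under rotations of two rows,
   and using that the columns are orthonormal, gives the integration by parts
     (n - 2 + X) M(x + e_k; y) + sum_j x_j M(x - e_j; y + e_j + e_k)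
       = x_k M(x - e_k; y),
   which determines M from the moments of a single row. It is solved by
     (X + n - 2)!! (Y + n - 2)!! M(x; y)
       = (n - 2)!! (n - 1)!! L_(X + Y) (prod_j w(x_j, y_j)),
   where w(a, b) is the mixed moment E[U^a V^b] of two standard Gaussian variables,
   as a polynomial in their correlation, and L_d is an explicit linear functional
   on polynomials. Since w is symmetric, the right-hand side is unchanged when the
   two entries of any column are exchanged. *)

Set Implicit Arguments.
Unset Strict Implicit.
Unset Printing Implicit Defensive.

Import Order.TTheory GRing.Theory Num.Theory.
Import numFieldNormedType.Exports.

Local Open Scope classical_set_scope.
Local Open Scope ring_scope.

(** * Integration over the orthogonal group *)

Lemma mulmx_left_continuous (R : realType) (n : nat) (g : 'M[R]_n) :
  continuous (fun A : 'M[R]_n => g *m A).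
Proof.
move=> A U [P nP sPU].
have cij i j : continuous (fun B : 'M[R]_n => (g *m B) i j).
  have -> : (fun B : 'M[R]_n => (g *m B) i j) =
      (fun B => \sum_k g i k * B k j).
    by apply/funext => B; rewrite mxE.
  apply: (@continuous_big R^o _ +%R); first exact: add_continuous.
  by move=> k _ B; apply: continuousM; [exact: cst_continuous | exact: coord_continuous].
have : nbhs A (fun B => forall i j, P i j ((g *m B) i j)).
  have hi i : nbhs A (fun B => forall j, P i j ((g *m B) i j)).
    by apply: (@filter_forall _ _ _ (nbhs A)) => j; exact: (cij i j A _ (nP i j)).
  exact: (@filter_forall _ _ _ (nbhs A) _ hi).
by apply: filterS => B PB; exact: sPU.
Qed.

Section Bounded.
Variables (R : realType) (n : nat).
Local Notation On := (orthogonal_borel R n).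

Lemma orthogonal_entry_measurable (i j : 'I_n) :
  measurable_fun setT (fun u : On => orthogonal_mx u i j).
Proof.
apply: (measurability _ (RGenOpens.measurableE R)).
move=> _ [_ [a [b ->]] <-]; rewrite setTI.
apply: sub_sigma_algebra.
exists ((fun M : 'M[R]_n => M i j) @^-1` `]a, b[) => //.
have /continuousP := @coord_continuous R n n i j.
by apply; exact: interval_open.
Qed.

Lemma orthogonal_mul_measurable (g : Defs.orthogonal R n) :
  measurable_fun setT (fun u : On => (g * u)%g : On).
Proof.
apply: (@measurability _ _ On On setT _ (@open (Defs.orthogonal R n))) => //.
move=> _ [_ [V oV <-]] <-; rewrite setTI.
apply: sub_sigma_algebra.
exists ((fun M : 'M[R]_n => orthogonal_mx g *m M) @^-1` V) => //.
by move/continuousP: (@mulmx_left_continuous R n g); apply.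
Qed.

(** A class closed under sums and products that contains the matrix entries; under a probability
    measure every polynomial in the entries is then integrable. *)
Definition bounded_measurable (f : On -> R) :=
  measurable_fun setT f /\ exists K, forall u, `|f u| <= K.

Lemma bounded_measurable_cst (c : R) : bounded_measurable (fun=> c).
Proof. by split=> //; exists `|c|. Qed.

Lemma bounded_measurableD f g : bounded_measurable f -> bounded_measurable g ->
  bounded_measurable (fun u => f u + g u).
Proof.
move=> [mf [K hK]] [mg [L hL]]; split; first exact: measurable_funD.
exists (K + L) => u; apply: le_trans (ler_normD _ _) _; exact: lerD.
Qed.

Lemma bounded_measurableM f g : bounded_measurable f -> bounded_measurable g ->
  bounded_measurable (fun u => f u * g u).
Proof.
move=> [mf [K hK]] [mg [L hL]]; split; first exact: measurable_funM.
by exists (K * L) => u; rewrite normrM; apply: ler_pM.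
Qed.

Lemma bounded_measurable_sum (I : Type) (r : seq I) (P : pred I)
    (f : I -> On -> R) : (forall i, bounded_measurable (f i)) ->
  bounded_measurable (fun u => \sum_(i <- r | P i) f i u).
Proof.
move=> hf; elim: r => [|i r IH].
  under eq_fun do rewrite big_nil; exact: bounded_measurable_cst.
under eq_fun do rewrite big_cons.
by case: (P i) => //; exact: bounded_measurableD.
Qed.

Lemma bounded_measurable_prod (I : Type) (r : seq I) (P : pred I)
    (f : I -> On -> R) : (forall i, bounded_measurable (f i)) ->
  bounded_measurable (fun u => \prod_(i <- r | P i) f i u).
Proof.
move=> hf; elim: r => [|i r IH].
  under eq_fun do rewrite big_nil; exact: bounded_measurable_cst.
under eq_fun do rewrite big_cons.
by case: (P i) => //; exact: bounded_measurableM.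
Qed.

Lemma bounded_measurableX f k : bounded_measurable f ->
  bounded_measurable (fun u => f u ^+ k).
Proof.
move=> hf; elim: k => [|k IH].
  under eq_fun do rewrite expr0; exact: bounded_measurable_cst.
by under eq_fun do rewrite exprS; exact: bounded_measurableM.
Qed.

Lemma orthogonal_col (u : Defs.orthogonal R n) (j k : 'I_n) :
  \sum_i orthogonal_mx u i j * orthogonal_mx u i k = (j == k)%:R.
Proof.
have := mulmx1C (eqP (orthogonal_mxP u)) => /matrixP/(_ j k); rewrite !mxE => <-.
by apply: eq_bigr => i _; rewrite mxE.
Qed.

Lemma bounded_measurable_entry (i j : 'I_n) :
  bounded_measurable (fun u => orthogonal_mx u i j).
Proof.
split; first exact: orthogonal_entry_measurable.
(* Each column is a unit vector, so the square of an entry is at most 1. *)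
exists 1 => u; rewrite -(@expr_le1 _ 2)// real_normK ?num_real//.
have : \sum_k orthogonal_mx u k j * orthogonal_mx u k j = 1.
  by rewrite orthogonal_col eqxx.
move=> <-.
rewrite (bigD1 i)//= -expr2 lerDl; apply: sumr_ge0 => k _.
by rewrite -expr2 sqr_ge0.
Qed.

Variable mu : probability On R.

Lemma bounded_measurable_integrable f : bounded_measurable f ->
  mu.-integrable setT (EFin \o f).
Proof.
move=> [mf [K hK]]; apply: measurable_bounded_integrable => //.
  by have := fin_num_measure mu setT measurableT; rewrite ge0_fin_numE.
by exists K; split; rewrite ?num_real// => x Kx u _; exact: le_trans (hK u) (ltW Kx).
Qed.

Lemma expect_sum (I : Type) (r : seq I) (P : pred I) (f : I -> On -> R) :
  (forall i, bounded_measurable (f i)) ->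
  \int[mu]_u (\sum_(i <- r | P i) f i u) = \sum_(i <- r | P i) \int[mu]_u f i u.
Proof.
move=> hf; elim: r => [|i r IH].
  by under eq_Rintegral do rewrite big_nil; rewrite big_nil Rintegral_cst// mul0r.
under eq_Rintegral do rewrite big_cons; rewrite big_cons.
case: ifP => // Pi; rewrite RintegralD ?IH//.
  exact: bounded_measurable_integrable.
by apply: bounded_measurable_integrable; exact: bounded_measurable_sum.
Qed.

Lemma expectZ c f : bounded_measurable f ->
  \int[mu]_u (c * f u) = c * \int[mu]_u f u.
Proof. by move=> hf; rewrite RintegralZl//; exact: bounded_measurable_integrable. Qed.

Lemma haar_invariant (g : Defs.orthogonal R n) f : is_haar mu ->
  bounded_measurable f -> \int[mu]_u f (g * u)%g = \int[mu]_u f u.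
Proof.
move=> hmu [mf [K hK]]; have mg := orthogonal_mul_measurable g.
have mEf : measurable_fun setT (EFin \o f) by exact/measurable_EFinP.
have intf : mu.-integrable setT ((EFin \o f) \o (fun u : On => (g * u)%g : On)).
  apply: (@bounded_measurable_integrable (fun u => f (g * u)%g)).
  by split; [exact: (measurableT_comp mf mg) | exists K].
have := @integral_pushforward _ _ On On R _ mg mu setT _ mEf intf measurableT.
rewrite preimage_setT /Rintegral => <-; congr fine.
apply: eq_measure_integral => A mA _.
rewrite /= /pushforward.
(* [is_haar] speaks of images: the preimage of [A] under translation by [g] is its image under
   translation by [g^-1]. *)
have <- := hmu g^-1%g A mA.
congr (mu _); apply/seteqP; split=> u /=.
  by move=> Au; exists (g * u)%g => //; rewrite mulKg.
by move=> [v Av <-]; rewrite mulVKg.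
Qed.

End Bounded.

(** * Exponents, polynomial coefficients and rotations *)

Section Exponents.
Variable T : eqType.
Implicit Types (a : T -> nat) (i j : T).

Definition incr a i : T -> nat := fun j => (a j + (j == i))%N.
(** The subtraction truncates at a zero exponent. In the relations below such a term also carries
    that exponent as a coefficient, so it vanishes. *)
Definition decr a i : T -> nat := fun j => (a j - (j == i))%N.

Lemma incrK i a : decr (incr a i) i = a.
Proof. by apply/funext => j; rewrite /incr /decr addnK. Qed.

Lemma decrK i a : (0 < a i)%N -> incr (decr a i) i = a.
Proof.
move=> ai; apply/funext => j; rewrite /incr /decr subnK//.
by case: eqP => // ->.
Qed.

Lemma incrC i j a : incr (incr a i) j = incr (incr a j) i.
Proof. by apply/funext => k; rewrite /incr addnAC. Qed.

Lemma decr_incr i j a : (0 < a i)%N -> decr (incr a j) i = incr (decr a i) j.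
Proof.
move=> ai; apply/funext => k; rewrite /incr /decr; case: (eqVneq k i) => [->|_]; lia.
Qed.

End Exponents.

Section FiniteExponents.
Variable T : finType.
Implicit Types (a : T -> nat) (i j : T).

Lemma prod_incr (K : comPzSemiRingType) (z : T -> K) a i :
  \prod_j z j ^+ incr a i j = z i * \prod_j z j ^+ a j.
Proof.
rewrite (bigD1 i)//= [in RHS](bigD1 i)//= mulrA -exprS /incr eqxx addn1.
by congr (_ * _); apply: eq_bigr => j /negPf ->; rewrite addn0.
Qed.

Lemma sum_incr a i : (\sum_j incr a i j = (\sum_j a j).+1)%N.
Proof.
rewrite big_split/= [X in (_ + X)%N](bigD1 i)//= eqxx.
rewrite [X in (_ + (_ + X))%N]big1 ?addn1//.
by move=> j /negPf ->.
Qed.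

Lemma sum_decr a i : (0 < a i)%N -> ((\sum_j decr a i j).+1 = \sum_j a j)%N.
Proof. by move=> ai; rewrite -{2}(decrK ai) sum_incr. Qed.

Lemma sum_delta (K : pzSemiRingType) i (F : T -> K) : \sum_j (j == i)%:R * F j = F i.
Proof.
by rewrite (bigD1 i)//= eqxx mul1r big1 ?addr0// => j /negPf ->; rewrite mul0r.
Qed.

Lemma sum_incr_mul (K : pzSemiRingType) a i (F : T -> K) :
  \sum_j (incr a i j)%:R * F j = F i + \sum_j (a j)%:R * F j.
Proof.
under eq_bigr do rewrite /incr natrD mulrDl addrC.
by rewrite big_split/= sum_delta.
Qed.

End FiniteExponents.

(** * Low-order coefficients of products of polynomials *)

Lemma deriv_prod (K : comNzRingType) (T : eqType) (F : T -> {poly K}) (r : seq T) :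
  uniq r -> (\prod_(i <- r) F i)^`() =
  \sum_(i <- r) (F i)^`() * \prod_(j <- r | j != i) F j.
Proof.
elim: r => [|k r IH] /=; first by rewrite !big_nil derivC.
move=> /andP[kr ur]; rewrite !big_cons derivM IH// eqxx /=.
congr (_ * _ + _).
  rewrite [LHS]big_seq [RHS]big_seq_cond; apply: eq_bigl => j.
  by case: (boolP (j \in r)) => //= jr; apply/esym; apply: contra kr => /eqP <-.
rewrite big_distrr/= big_seq [RHS]big_seq; apply: eq_bigr => j jr.
rewrite big_cons ifT; first by ring.
by apply: contra kr => /eqP ->.
Qed.

Lemma coef1_deriv (K : nzSemiRingType) (p : {poly K}) : p`_1 = p^`()`_0.
Proof. by rewrite coef_deriv mulr1n. Qed.

Lemma coef0_exp (K : comNzRingType) (p : {poly K}) k : (p ^+ k)`_0 = p`_0 ^+ k.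
Proof. by rewrite -!horner_coef0 horner_exp. Qed.

Lemma coef1_exp (K : comNzRingType) (p : {poly K}) k :
  (p ^+ k)`_1 = k%:R * p`_1 * p`_0 ^+ k.-1.
Proof.
rewrite coef1_deriv deriv_exp coefMn coef0M coef0_exp -coef1_deriv.
by rewrite mulr_natl mulrnAl.
Qed.

(** The linear coefficient is the derivative at zero: this differentiates a monomial along a
    polynomial curve without any analysis. *)
Lemma coef1_monomial (K : comNzRingType) (T : finType) (Z : T -> {poly K}) (a : T -> nat) :
  (\prod_i Z i ^+ a i)`_1 =
  \sum_i (a i)%:R * ((Z i)`_1 * \prod_j (Z j)`_0 ^+ decr a i j).
Proof.
rewrite coef1_deriv deriv_prod ?index_enum_uniq// coef_sum; apply: eq_bigr => i _.
rewrite coef0M -coef1_deriv coef1_exp coef0_prod [in RHS](bigD1 i)//= /decr eqxx subn1.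
rewrite -!mulrA; do 3 congr (_ * _).
by apply: eq_bigr => j /negPf ->; rewrite subn0 coef0_exp.
Qed.

Lemma poly_horner_inj (R : realType) (p q : {poly R}) :
  (forall t, p.[t] = q.[t]) -> p = q.
Proof.
move=> h; apply/eqP; rewrite -subr_eq0; apply/eqP.
(* The integers below the size of the difference are distinct roots, one too many for a nonzero
   polynomial. *)
apply: (@roots_geq_poly_eq0 _ _ [seq i%:R | i <- iota 0 (size (p - q))]).
- by apply/allP => t _; rewrite rootE hornerD hornerN h subrr.
- rewrite map_inj_uniq ?iota_uniq// => i j /eqP.
  by rewrite eqr_nat => /eqP.
- by rewrite size_map size_iota.
Qed.

(** * Plane rotations as products of two reflections *)

Section Rotations.
Variables (R : realType) (n : nat).

(** With c |v|^2 = 2 this is the Householder reflection along [v]: it is symmetric and squares to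
    the identity. *)
Lemma householder_orthogonal (v : 'cV[R]_n) (c : R) :
  c * \sum_k v k 0 ^+ 2 = 2 ->
  (1%:M - c *: (v *m v^T)) *m (1%:M - c *: (v *m v^T))^T == 1%:M.
Proof.
move=> hc; apply/eqP.
have vv : v^T *m v = (\sum_k v k 0 ^+ 2)%:M.
  apply/matrixP => a b; rewrite !ord1 !mxE eqxx mulr1n.
  by apply: eq_bigr => k _; rewrite mxE expr2.
have P2 : (v *m v^T) *m (v *m v^T) = (\sum_k v k 0 ^+ 2) *: (v *m v^T).
  by rewrite mulmxA -(mulmxA v) vv mul_mx_scalar -scalemxAl.
have -> : (1%:M - c *: (v *m v^T))^T = 1%:M - c *: (v *m v^T).
  by rewrite raddfB/= trmx1 [in LHS]scalemxAl trmx_mul trmxK linearZ/= -scalemxAr.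
rewrite mulmxBl mul1mx mulmxBr mulmx1 -scalemxAl -scalemxAr P2 !scalerA.
by rewrite -mulrA hc mulr_natr mulr2n scalerDl opprB addrK subrK.
Qed.

Definition reflection_axis (i l : 'I_n) (t : R) : 'cV[R]_n :=
  \col_k ((k == i)%:R + t * (k == l)%:R).

Lemma reflection_axis_mul (i l : 'I_n) t (F : 'I_n -> R) :
  \sum_k reflection_axis i l t k 0 * F k = F i + t * F l.
Proof.
rewrite -[F i](sum_delta i) -[F l](sum_delta l) big_distrr -big_split/=.
by apply: eq_bigr => k _; rewrite mxE mulrDl mulrA.
Qed.

Lemma one_plus_sqr_neq0 (t : R) : 1 + t ^+ 2 != 0.
Proof. by rewrite gt_eqF// ltr_pwDl// sqr_ge0. Qed.

Lemma reflection_axis_norm (i l : 'I_n) t : i != l ->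
  2 / (1 + t ^+ 2) * \sum_k reflection_axis i l t k 0 ^+ 2 = 2.
Proof.
move=> il; under eq_bigr do rewrite expr2; rewrite reflection_axis_mul !mxE !eqxx.
rewrite (negPf il) eq_sym (negPf il) !mulr0 mulr1 addr0 add0r -expr2 divfK//.
exact: one_plus_sqr_neq0.
Qed.

Definition reflection (i l : 'I_n) (t : R) (il : i != l) : Defs.orthogonal R n :=
  Defs.Orthogonal (householder_orthogonal (reflection_axis_norm t il)).

Lemma reflection_mulE (i l : 'I_n) t (il : i != l) (u : Defs.orthogonal R n) r j :
  orthogonal_mx (reflection t il * u)%g r j =
  u r j - 2 / (1 + t ^+ 2) * ((r == i)%:R + t * (r == l)%:R) * (u i j + t * u l j).
Proof.
rewrite /= mulmxBl mul1mx -scalemxAl -mulmxA !mxE.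
congr (_ - _); rewrite -mulrA; congr (_ * _).
rewrite big_ord1 mxE; congr (_ * _).
rewrite mxE -(reflection_axis_mul i l t (fun k => u k j)).
by apply: eq_bigr => k _; rewrite mxE.
Qed.

(** Two reflections whose axes differ by the angle arctan t compose to the rotation by 2 arctan t.
    This is the rational parametrization of the circle, so the entries become polynomial in t once
    multiplied by 1 + t^2. *)
Lemma rotation_mulE (i l : 'I_n) t (il : i != l) (u : Defs.orthogonal R n) r j :
  orthogonal_mx (reflection t il * reflection 0 il * u)%g r j =
  (1 + t ^+ 2)^-1 *
  (if r == i then (1 - t ^+ 2) * u i j - 2 * t * u l j
   else if r == l then (1 - t ^+ 2) * u l j + 2 * t * u i j
   else (1 + t ^+ 2) * u r j).
Proof.
have h0 := one_plus_sqr_neq0 t.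
rewrite -mulgA !reflection_mulE !eqxx (negPf il) (eq_sym l i) (negPf il) expr0n/= addr0.
case: (eqVneq r i) => [->|ri]; first by rewrite (negPf il)/=; field.
by case: (eqVneq r l) => [->|rl] /=; field.
Qed.

End Rotations.

(** * Moments of the Haar measure *)

Section Moments.
Variables (R : realType) (n : nat).
Local Notation On := (orthogonal_borel R n).
Local Notation pos := ('I_n * 'I_n)%type.
Variables (mu : probability On R) (mu_haar : is_haar mu).
Implicit Types (A : pos -> nat).

Definition monomial A (M : 'M[R]_n) : R := \prod_p M p.1 p.2 ^+ A p.

Definition moment A : R := \int[mu]_u monomial A (orthogonal_mx u).

Lemma bounded_monomial A : bounded_measurable (fun u : On => monomial A (orthogonal_mx u)).
Proof.
apply: bounded_measurable_prod => p; apply: bounded_measurableX.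
exact: bounded_measurable_entry.
Qed.

Lemma monomial_incr A p M : monomial (incr A p) M = M p.1 p.2 * monomial A M.
Proof. exact: (prod_incr (fun p : pos => M p.1 p.2)). Qed.

Lemma bounded_measurable_translate (g : Defs.orthogonal R n) (f : On -> R) :
  bounded_measurable f -> bounded_measurable (fun u => f (g * u)%g).
Proof.
move=> [mf [K hK]]; split; last by exists K.
exact: (measurableT_comp mf (orthogonal_mul_measurable g)).
Qed.

(** The degree bound is uniform in [u], so that integrating coefficient by coefficient yields a
    polynomial. *)
Definition bounded_coefs (P : On -> {poly R}) :=
  (forall k, bounded_measurable (fun u => (P u)`_k)) /\
  exists N, forall u, (size (P u) <= N)%N.

Lemma bounded_coefs_cst p : bounded_coefs (fun=> p).
Proof. by split=> [k|]; [exact: bounded_measurable_cst | exists (size p)]. Qed.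

Lemma bounded_coefsC f : bounded_measurable f -> bounded_coefs (fun u => (f u)%:P).
Proof.
move=> hf; split=> [[|k]|].
- by under eq_fun do rewrite coefC.
- by under eq_fun do rewrite coefC; exact: bounded_measurable_cst.
- by exists 1%N => u; exact: size_polyC_leq1.
Qed.

Lemma bounded_coefsD P Q : bounded_coefs P -> bounded_coefs Q ->
  bounded_coefs (fun u => P u + Q u).
Proof.
move=> [hP [N hN]] [hQ [L hL]]; split=> [k|].
  by under eq_fun do rewrite coefD; exact: bounded_measurableD.
exists (maxn N L) => u; apply: leq_trans (size_polyD _ _) _.
by rewrite geq_max !leq_max hN hL orbT.
Qed.

Lemma bounded_coefsM P Q : bounded_coefs P -> bounded_coefs Q ->
  bounded_coefs (fun u => P u * Q u).
Proof.
move=> [hP [N hN]] [hQ [L hL]]; split=> [k|].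
  under eq_fun do rewrite coefM.
  by apply: bounded_measurable_sum => j; exact: bounded_measurableM.
exists (N + L)%N => u; apply: leq_trans (size_polyMleq _ _) _.
by have := hN u; have := hL u; lia.
Qed.

Lemma bounded_coefs_prod (I : Type) (r : seq I) (P : I -> On -> {poly R}) :
  (forall i, bounded_coefs (P i)) -> bounded_coefs (fun u => \prod_(i <- r) P i u).
Proof.
move=> hP; elim: r => [|i r IH].
  by under eq_fun do rewrite big_nil; exact: bounded_coefs_cst.
by under eq_fun do rewrite big_cons; exact: bounded_coefsM.
Qed.

Lemma bounded_coefsX P k : bounded_coefs P -> bounded_coefs (fun u => P u ^+ k).
Proof.
move=> hP; elim: k => [|k IH].
  by under eq_fun do rewrite expr0; exact: bounded_coefs_cst.
by under eq_fun do rewrite exprS; exact: bounded_coefsM.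
Qed.

(* The entries of [rotation_mulE], with the denominator [1 + t^2] cleared. *)
Definition rotation_entry (i l : 'I_n) (p : pos) (u : On) : {poly R} :=
  if p.1 == i then
    (1 - 'X^2) * (orthogonal_mx u i p.2)%:P + (-2%:P * 'X) * (orthogonal_mx u l p.2)%:P
  else if p.1 == l then
    (1 - 'X^2) * (orthogonal_mx u l p.2)%:P + (2%:P * 'X) * (orthogonal_mx u i p.2)%:P
  else (1 + 'X^2) * (orthogonal_mx u p.1 p.2)%:P.

Lemma bounded_rotation_entry i l p : bounded_coefs (rotation_entry i l p).
Proof.
have h q r j : bounded_coefs (fun u => q * (orthogonal_mx u r j)%:P).
  apply: bounded_coefsM; first exact: bounded_coefs_cst.
  by apply: bounded_coefsC; exact: bounded_measurable_entry.
rewrite /rotation_entry; case: eqP => _; first exact: bounded_coefsD.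
by case: eqP => _; first exact: bounded_coefsD.
Qed.

Lemma rotation_entry_horner i l (il : i != l) p u t :
  (rotation_entry i l p u).[t] = (1 + t ^+ 2) *
  orthogonal_mx (reflection t il * reflection 0 il * u)%g p.1 p.2.
Proof.
rewrite rotation_mulE mulrA divff ?one_plus_sqr_neq0// mul1r /rotation_entry.
case: eqP => _; first by rewrite !hornerE; ring.
by case: eqP => _; rewrite !hornerE; ring.
Qed.

Lemma rotation_entry_coef0 i l p u :
  (rotation_entry i l p u)`_0 = orthogonal_mx u p.1 p.2.
Proof.
rewrite -horner_coef0 /rotation_entry.
case: eqP => [->|_]; first by rewrite !hornerE; ring.
by case: eqP => [->|_]; rewrite !hornerE; ring.
Qed.

Lemma rotation_entry_coef1 i l p u : (rotation_entry i l p u)`_1 =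
  2 * ((p.1 == l)%:R * (p.1 != i)%:R * orthogonal_mx u i p.2
       - (p.1 == i)%:R * orthogonal_mx u l p.2).
Proof.
rewrite /rotation_entry; case: eqP => _; last case: eqP => _.
all: rewrite ?coefD !coefMC ?coefD ?coefN ?coefCM ?coef1 ?coefXn ?coefX /=.
all: by rewrite ?coefMN ?coefNM ?mulNr ?coefN ?coefCM ?coefX /=; ring.
Qed.

(** The derivative at t = 0 of the invariance of the moment under rotations in the plane of rows [i]
    and [l]. It is read off as the linear coefficient of an identity between polynomials in t. *)
Lemma moment_rotation i l A : i != l ->
  \sum_j (A (l, j))%:R * moment (incr (decr A (l, j)) (i, j)) =
  \sum_j (A (i, j))%:R * moment (incr (decr A (i, j)) (l, j)).
Proof.
move=> il; pose D := (\sum_p A p)%N.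
pose P u := \prod_p rotation_entry i l p u ^+ A p.
have [hP [N hN]] : bounded_coefs P.
  by apply: bounded_coefs_prod => p; apply: bounded_coefsX; exact: bounded_rotation_entry.
have PE u t : (P u).[t] =
    (1 + t ^+ 2) ^+ D * monomial A (orthogonal_mx (reflection t il * reflection 0 il * u)%g).
  rewrite horner_prod /monomial /D -prodrXr -big_split/=; apply: eq_bigr => p _.
  by rewrite horner_exp rotation_entry_horner exprMn.
have {}hN u : (size (P u) <= N.+2)%N by apply: leq_trans (hN u) _; rewrite leqW.
(* Invariance holds at every real t, hence as an identity of polynomials; [D] factors 1 + t^2 clear
   the denominators. *)
have QE : \poly_(k < N.+2) (\int[mu]_u (P u)`_k) = (1 + 'X^2) ^+ D * (moment A)%:P.
  apply: poly_horner_inj => t; rewrite horner_poly !hornerE.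
  pose g := (reflection t il * reflection 0 il)%g.
  have -> : moment A = \int[mu]_u monomial A (orthogonal_mx (g * u)%g).
    by symmetry; exact: (haar_invariant g mu_haar (bounded_monomial A)).
  rewrite -expectZ; last exact: (bounded_measurable_translate g (bounded_monomial A)).
  under eq_Rintegral do rewrite -PE.
  under [RHS]eq_Rintegral => u _ do rewrite (horner_coef_wide _ (hN u)).
  rewrite expect_sum; last first.
    by move=> k; apply: bounded_measurableM => //; exact: bounded_measurable_cst.
  apply: eq_bigr => k _; under [RHS]eq_Rintegral do rewrite mulrC.
  by rewrite expectZ; [exact: mulrC | exact: hP].
(* The right-hand side of [QE] is even in t. *)
have : \int[mu]_u (P u)`_1 = 0.
  have := congr1 (fun q : {poly R} => q`_1) QE.
  rewrite coef_poly/= => ->.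
  by rewrite coefMC coef1_exp coefD coef1 coefXn /= addr0 mulr0 !mul0r.
have bm p j : bounded_measurable (fun u : On => orthogonal_mx u j p.2 *
   monomial (decr A p) (orthogonal_mx u)).
  by apply: bounded_measurableM; [exact: bounded_measurable_entry | exact: bounded_monomial].
have -> : \int[mu]_u (P u)`_1 = \int[mu]_u (\sum_p (2 * (A p)%:R *
   ((p.1 == l)%:R * (orthogonal_mx u i p.2 * monomial (decr A p) (orthogonal_mx u))
   + - (p.1 == i)%:R * (orthogonal_mx u l p.2 * monomial (decr A p) (orthogonal_mx u))))).
  apply: eq_Rintegral => u _; rewrite /P coef1_monomial; apply: eq_bigr => p _.
  under eq_bigr do rewrite rotation_entry_coef0.
  rewrite rotation_entry_coef1 -/(monomial (decr A p) _).
  case: (eqVneq p.1 i) => [->|_] /=; last by ring.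
  by rewrite (negPf il) mulr0n; ring.
have bmZ p j e : bounded_measurable (fun u : On => e * (orthogonal_mx u j p.2 *
   monomial (decr A p) (orthogonal_mx u))).
  by apply: bounded_measurableM => //; exact: bounded_measurable_cst.
rewrite expect_sum; last first.
  move=> p; apply: bounded_measurableM; first exact: bounded_measurable_cst.
  by apply: bounded_measurableD.
under eq_bigr => p _.
  rewrite expectZ; last by apply: bounded_measurableD.
  rewrite RintegralD ?(expectZ _ _ (bm _ _))//;
    try exact: bounded_measurable_integrable (bmZ _ _ _).
  under eq_Rintegral do rewrite -(monomial_incr _ (i, p.2)).
  under [X in _ + _ * X]eq_Rintegral do rewrite -(monomial_incr _ (l, p.2)).
  rewrite -/(moment _) -/(moment _).
  over.
move=> h0.
(* Grouping the positions by row leaves only the rows [i] and [l], which are the two sides of the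
   claim. *)
pose G r := \sum_j 2 * (A (r, j))%:R *
    ((r == l)%:R * moment (incr (decr A (r, j)) (i, j)) +
     - (r == i)%:R * moment (incr (decr A (r, j)) (l, j))).
have : \sum_r G r = 0.
  by rewrite pair_bigA/= -[RHS]h0; apply: eq_bigr => -[r j] _.
have li : l != i by rewrite eq_sym.
rewrite (bigD1 i)//= (bigD1 l)//= [X in _ + (_ + X)]big1; last first.
  move=> r /andP[/negPf ri /negPf rl].
  by rewrite /G big1// => j _; rewrite ri rl mulr0n; ring.
rewrite addr0 /G !eqxx (negPf il) (negPf li) => h.
apply: (@mulfI _ 2); first by rewrite pnatr_eq0.
apply/eqP; rewrite -subr_eq0; apply/eqP; rewrite -[RHS]h addrC !big_distrr -sumrN.
by congr (_ + _); apply: eq_bigr => j _; rewrite mulr0n mulr1n /=; ring.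
Qed.
End Moments.

(** * Integration by parts and parity for moments *)

Section MomentRelations.
Variables (R : realType) (n : nat).
Local Notation On := (orthogonal_borel R n).
Local Notation pos := ('I_n * 'I_n)%type.
Variables (mu : probability On R) (mu_haar : is_haar mu).
Implicit Types (A : pos -> nat).
Local Notation moment := (moment mu).

Lemma moment_column A k j :
  \sum_l moment (incr (incr A (l, k)) (l, j)) = (k == j)%:R * moment A.
Proof.
rewrite -expect_sum; last by move=> l; exact: bounded_monomial.
rewrite -expectZ; last exact: bounded_monomial.
apply: eq_Rintegral => u _; rewrite -(orthogonal_col u) big_distrl/=.
by apply: eq_bigr => l _; rewrite !monomial_incr/=; ring.
Qed.

(** Apply [moment_rotation] to [incr A (l, k)] for each [l != i] and sum. Every [l] produces one
    extra copy of [moment (incr A (i, k))], whence [n.-1]; on the other side orthonormality of the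
    columns evaluates the sum over [l]. *)
Lemma moment_by_parts i k A :
  (n.-1 + \sum_j A (i, j))%:R * moment (incr A (i, k)) +
  \sum_(l | l != i) \sum_j (A (l, j))%:R *
     moment (incr (decr (incr A (l, k)) (l, j)) (i, j)) =
  (A (i, k))%:R * moment (decr A (i, k)).
Proof.
have rot l : l != i -> moment (incr A (i, k)) +
    \sum_j (A (l, j))%:R * moment (incr (decr (incr A (l, k)) (l, j)) (i, j)) =
    \sum_j (A (i, j))%:R * moment (incr (incr (decr A (i, j)) (l, k)) (l, j)).
  move=> li; have il : i != l by rewrite eq_sym.
  have := moment_rotation mu_haar (incr A (l, k)) il.
  have -> : \sum_j (incr A (l, k) (i, j))%:R *
      moment (incr (decr (incr A (l, k)) (i, j)) (l, j)) =
    \sum_j (A (i, j))%:R * moment (incr (incr (decr A (i, j)) (l, k)) (l, j)).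
    apply: eq_bigr => j _; rewrite {1}/incr xpair_eqE (negPf il) addn0.
    have [->|Aij] := posnP (A (i, j)); first by rewrite !mul0r.
    by rewrite decr_incr.
  move=> <-; pose F j := moment (incr (decr (incr A (l, k)) (l, j)) (i, j)).
  have Fk : moment (incr A (i, k)) = F k by rewrite /F incrK.
  rewrite Fk -(sum_incr_mul (fun j => A (l, j)) k F); apply: eq_bigr => j _.
  by rewrite /incr xpair_eqE eqxx.
have := eq_bigr (op := +%R) (idx := 0) (r := index_enum 'I_n) _ rot.
rewrite big_split/= sumr_const cardC1 card_ord [in RHS]exchange_big/= => h.
rewrite natrD mulrDl [X in X + _]addrC -addrA (mulr_natl _ n.-1) {}h.
(* The terms from [\sum_j A (i, j)] supply the missing index [l = i]. By [moment_column], each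
   column [j != k] then contributes zero and column [k] gives the right-hand side. *)
rewrite natr_sum big_distrl/= -big_split/= (bigD1 k)//= [X in _ + X]big1 ?addr0 => [|j jk].
  have -> : \sum_(l | l != i) (A (i, k))%:R * moment (incr (incr (decr A (i, k)) (l, k)) (l, k))
     = (A (i, k))%:R * (moment (decr A (i, k)) - 
         moment (incr (incr (decr A (i, k)) (i, k)) (i, k))).
    rewrite -big_distrr/=; congr (_ * _).
    have := moment_column (decr A (i, k)) k k.
    by rewrite eqxx mul1r (bigD1 i)//= => <-; rewrite [RHS]addrC addKr.
  have [->|Aik] := posnP (A (i, k)); first by ring.
  by rewrite decrK//; ring.
rewrite -big_distrr/=.
have := moment_column (decr A (i, j)) k j; rewrite (bigD1 i)//= eq_sym (negPf jk) mul0r.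
have [->|Aij] := posnP (A (i, j)) => h; first by rewrite !mul0r addr0.
by rewrite -mulrDr; move: h; rewrite incrC decrK// => ->; rewrite mulr0.
Qed.

(** [reflection 0 il] changes the sign of row [i] and fixes the other rows, so a monomial of odd
    degree in row [i] changes sign. *)
Lemma moment_odd_row i l A : i != l -> odd (\sum_j A (i, j)) -> moment A = 0.
Proof.
move=> il oA; suff : moment A = - moment A by lra.
rewrite -mulN1r -expectZ; last exact: bounded_monomial.
rewrite -[LHS](haar_invariant (reflection 0 il) mu_haar (bounded_monomial _ A)).
apply: eq_Rintegral => u _.
have -> : -1 = \prod_(p : pos) (if p.1 == i then -1 else 1) ^+ A p :> R.
  transitivity (\prod_r \prod_j (if r == i then -1 else 1) ^+ A (r, j) : R).
    rewrite (bigD1 i)//= eqxx prodrXr -signr_odd oA expr1 big1 ?mulr1// => r /negPf ->.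
    by apply: big1 => j _; rewrite expr1n.
  by rewrite pair_bigA/=; apply: eq_bigr => -[].
rewrite /monomial -big_split/=; apply: eq_bigr => p _; rewrite -exprMn; congr (_ ^+ _).
rewrite (reflection_mulE 0 il) expr0n/= addr0 !mul0r !addr0 divr1.
by case: eqP => [->|_]; rewrite ?mulr0n ?mulr1n; ring.
Qed.
End MomentRelations.

(** * Moments of two rows *)

Section TwoRows.
Variables (R : realType) (n : nat).
Local Notation On := (orthogonal_borel R n).
Local Notation pos := ('I_n * 'I_n)%type.
Variables (mu : probability On R) (mu_haar : is_haar mu).
Variables (i0 i1 : 'I_n) (i01 : i0 != i1).
Implicit Types (x y : 'I_n -> nat).

Definition two_rows x y (p : pos) : nat :=
  if p.1 == i0 then x p.2 else if p.1 == i1 then y p.2 else 0.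

Definition moment2 x y : R := moment mu (two_rows x y).

Lemma two_rows_fst x y j : two_rows x y (i0, j) = x j.
Proof. by rewrite /two_rows eqxx. Qed.

Lemma two_rows_snd x y j : two_rows x y (i1, j) = y j.
Proof. by rewrite /two_rows/= eq_sym (negPf i01) eqxx. Qed.

Lemma two_rows_other x y i j : i != i0 -> i != i1 -> two_rows x y (i, j) = 0.
Proof. by rewrite /two_rows/= => /negPf -> /negPf ->. Qed.

Lemma two_rows_incr_fst x y k : incr (two_rows x y) (i0, k) = two_rows (incr x k) y.
Proof.
apply/funext => -[r j]; rewrite /incr /two_rows xpair_eqE /=.
by case: eqP => //= _; rewrite addn0.
Qed.

Lemma two_rows_incr_snd x y k : incr (two_rows x y) (i1, k) = two_rows x (incr y k).
Proof.
apply/funext => -[r j]; rewrite /incr /two_rows xpair_eqE /=.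
case: (eqVneq r i0) => [->|_]; first by rewrite (negPf i01) addn0.
by case: eqP => //= _; rewrite addn0.
Qed.

Lemma two_rows_decr_fst x y k : decr (two_rows x y) (i0, k) = two_rows (decr x k) y.
Proof.
apply/funext => -[r j]; rewrite /decr /two_rows xpair_eqE /=.
by case: eqP => //= _; rewrite subn0.
Qed.

Lemma two_rows_decr_snd x y k : decr (two_rows x y) (i1, k) = two_rows x (decr y k).
Proof.
apply/funext => -[r j]; rewrite /decr /two_rows xpair_eqE /=.
case: (eqVneq r i0) => [->|_]; first by rewrite (negPf i01) subn0.
by case: eqP => //= _; rewrite subn0.
Qed.

Lemma moment2_rotation x y :
  \sum_j (y j)%:R * moment2 (incr x j) (decr y j) =
  \sum_j (x j)%:R * moment2 (decr x j) (incr y j).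
Proof.
have := moment_rotation mu_haar (two_rows x y) i01.
under eq_bigr do rewrite two_rows_snd two_rows_decr_snd two_rows_incr_fst.
by under [RHS]eq_bigr do rewrite two_rows_fst two_rows_decr_fst two_rows_incr_snd.
Qed.

(** All rows but [i0] and [i1] have zero exponents, so only [l = i1] survives in the sum of
    [moment_by_parts]. *)
Lemma moment2_by_parts x y k :
  (n.-1 + \sum_j x j)%:R * moment2 (incr x k) y +
  \sum_j (y j)%:R * moment2 (incr x j) (decr (incr y k) j) =
  (x k)%:R * moment2 (decr x k) y.
Proof.
have := moment_by_parts mu_haar i0 k (two_rows x y).
rewrite two_rows_incr_fst two_rows_fst two_rows_decr_fst => <-.
congr (_ + _); first by under [in RHS]eq_bigr do rewrite two_rows_fst.
rewrite [RHS](bigD1 i1) 1?eq_sym//= [X in _ = _ + X]big1 ?addr0 => [|i /andP[ii0 ii1]].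
  apply: eq_bigr => j _.
  by rewrite two_rows_snd two_rows_incr_snd two_rows_decr_snd two_rows_incr_fst.
by apply: big1 => j _; rewrite two_rows_other// mul0r.
Qed.

(* The rotation relation lowers the dimension factor from [n - 1 + X] to
   [n - 2 + X], the one in the recursion of the double factorials of [F_int]. *)
Lemma moment2_by_parts_rotated x y k :
  (n.-1 + \sum_j x j)%:R * moment2 (incr x k) y - moment2 (incr x k) y +
  \sum_j (x j)%:R * moment2 (decr x j) (incr (incr y k) j) =
  (x k)%:R * moment2 (decr x k) y.
Proof.
rewrite -moment2_by_parts -moment2_rotation.
by rewrite (sum_incr_mul y k (fun j => moment2 (incr x j) (decr (incr y k) j))) incrK; ring.
Qed.

Lemma moment2_odd x y : odd (\sum_j x j) -> moment2 x y = 0.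
Proof.
move=> ox; apply: (moment_odd_row mu_haar i01).
by under eq_bigr do rewrite two_rows_fst.
Qed.

Lemma moment2_0 : moment2 (fun=> 0%N) (fun=> 0%N) = 1.
Proof.
rewrite /moment2 /moment -[RHS]/(fine 1%:E) -(probability_setT mu).
rewrite -[RHS]mul1r -Rintegral_cst//; apply: eq_Rintegral => u _.
by rewrite /monomial big1// => p _; rewrite /two_rows; do !case: ifP.
Qed.

End TwoRows.

Lemma moment2C (R : realType) (n : nat) (mu : probability (orthogonal_borel R n) R)
    (i0 i1 : 'I_n) x y : i0 != i1 -> moment2 mu i0 i1 x y = moment2 mu i1 i0 y x.
Proof.
move=> i01; rewrite /moment2; congr (moment mu _); apply/funext => p.
rewrite /two_rows; case: (eqVneq p.1 i0) => // ->.
by rewrite (negPf i01).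
Qed.

(** * Wick polynomials *)

Lemma dfactS (m : nat) : dfact m.+2 = (m.+1 * dfact m)%N.
Proof.
rewrite /dfact big_mkcond big_nat_recr//= [in RHS]big_mkcond !negbK eqxx mulnC.
congr (_ * _)%N; case: m => [|m]; first by rewrite !big_geq.
(* The index just below the extracted factor has the wrong parity and drops out. *)
rewrite [LHS]big_nat_recr//=.
have -> : (odd m.+1 == ~~ odd m.+1) = false by case: odd.
by rewrite muln1; apply: eq_bigr => k _; rewrite /= ?negbK.
Qed.

Lemma dfact0 : dfact 0 = 1%N. Proof. by rewrite /dfact big_geq. Qed.

(** * Linear functionals on polynomials given by their moments *)

Section Functionals.
Variable R : comNzRingType.
Implicit Types (p q : {poly R}) (c : nat -> R).

Definition functional c p : R := \sum_(k < size p) p`_k * c k.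

Lemma functional_wide N c p : (size p <= N)%N ->
  functional c p = \sum_(k < N) p`_k * c k.
Proof.
move=> pN; rewrite /functional (big_ord_widen_cond N xpredT (fun k => p`_k * c k))//.
rewrite big_mkcond; apply: eq_bigr => k _; case: ltnP => //= pk.
by rewrite nth_default// mul0r.
Qed.

Lemma functionalD c p q : functional c (p + q) = functional c p + functional c q.
Proof.
pose N := maxn (size p) (size q).
rewrite (@functional_wide N) ?size_polyD// (@functional_wide N _ p) ?leq_maxl//.
rewrite (@functional_wide N _ q) ?leq_maxr// -big_split.
by apply: eq_bigr => k _; rewrite coefD mulrDl.
Qed.

Lemma functionalZ c e p : functional c (e *: p) = e * functional c p.
Proof.
rewrite (@functional_wide (size p)) ?size_scale_leq//.
rewrite [in RHS]/functional big_distrr/=.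
by apply: eq_bigr => k _; rewrite coefZ mulrA.
Qed.

Lemma functionalB c p q : functional c (p - q) = functional c p - functional c q.
Proof. by rewrite -scaleN1r functionalD functionalZ mulN1r. Qed.

Lemma functional_sum c (T : Type) (r : seq T) (F : T -> {poly R}) :
  functional c (\sum_(i <- r) F i) = \sum_(i <- r) functional c (F i).
Proof.
elim: r => [|i r IH]; last by rewrite !big_cons functionalD IH.
by rewrite !big_nil /functional size_poly0 big_ord0.
Qed.

Lemma functionalC c e : functional c e%:P = e * c 0%N.
Proof. by rewrite (@functional_wide 1) ?size_polyC_leq1// big_ord1 coefC. Qed.

Lemma functionalXM c p : functional c ('X * p) = functional (fun k => c k.+1) p.
Proof.
rewrite (@functional_wide (size p).+1); last first.
  by apply: leq_trans (size_polyMleq _ _) _; rewrite size_polyX.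
rewrite big_ord_recl coefXM mul0r add0r; apply: eq_bigr => k _.
by rewrite coefXM.
Qed.

(** Like [functionalXM], this transposes an operation on polynomials to the moment sequence. The
    predecessor at [k = 0] is harmless because the factor [k%:R] vanishes there. *)
Lemma functional_deriv c p :
  functional c p^`() = functional (fun k => k%:R * c k.-1) p.
Proof.
rewrite (@functional_wide (size p)); last first.
  by rewrite /deriv; apply: leq_trans (size_poly _ _) _; exact: leq_pred.
rewrite [RHS](@functional_wide (size p).+1)// big_ord_recl mul0r mulr0 add0r.
by apply: eq_bigr => k _; rewrite coef_deriv -[in LHS]mulr_natr -mulrA lift0.
Qed.

End Functionals.

Section WickPolynomials.
Variable R : comNzRingType.

(** The moment E[U^k] of a standard Gaussian variable; with the shifted convention of [dfact] no
    index changes. *)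
Definition gauss_moment k := if odd k then 0%N else dfact k.

Lemma gauss_momentS k : gauss_moment k.+1 = (k * gauss_moment k.-1)%N.
Proof.
case: k => [|k] //=; rewrite /gauss_moment /= negbK.
by case: odd; rewrite ?muln0// dfactS.
Qed.

Definition wick_coef a b k :=
  (k`! * 'C(a, k) * 'C(b, k) * gauss_moment (a - k) * gauss_moment (b - k))%N.

(* Wick's formula: the mixed moment E[U^a V^b] of standard Gaussian variables
   with correlation 'X; the summation index counts the mixed pairs. *)
Definition wick a b : {poly R} := \poly_(k < (a + b).+1) (wick_coef a b k)%:R.

Lemma wick_coef_eq0 a b k : (a + b < k.*2)%N -> wick_coef a b k = 0%N.
Proof.
move=> abk; rewrite /wick_coef; have [ak|ak] := ltnP a k.
  by rewrite (bin_small ak) !(muln0, mul0n).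
by rewrite (@bin_small b k) ?(muln0, mul0n)//; lia.
Qed.

Lemma coef_wick a b k : (wick a b)`_k = (wick_coef a b k)%:R.
Proof.
rewrite coef_poly; case: ltnP => // h; rewrite wick_coef_eq0//; lia.
Qed.

Lemma wickC a b : wick a b = wick b a.
Proof.
by apply/polyP => k; rewrite !coef_wick /wick_coef; congr (_%:R); ring.
Qed.

Lemma wick0l b : wick 0 b = (gauss_moment b)%:R%:P.
Proof.
apply/polyP => -[|k]; rewrite coef_wick coefC /wick_coef /=.
  by rewrite fact0 !bin0 !mul1n !subn0 [gauss_moment 0]dfact0 mul1n.
by rewrite muln0 !mul0n.
Qed.

(** Gaussian integration by parts: a distinguished U is paired with one of the [a] other U's, or
    with one of the [b] V's at the price of a factor ['X]. *)
Lemma wickSl a b : wick a.+1 b = a%:R *: wick a.-1 b + b%:R *: ('X * wick a b.-1).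
Proof.
apply/polyP => k; rewrite coefD !coefZ coefXM !coef_wick.
case: k => [|k] /=.
  rewrite mulr0 addr0 -natrM; congr (_%:R); rewrite /wick_coef !bin0 !subn0.
  by rewrite gauss_momentS; ring.
(* Pascal's rule separates the pairings: ['C(a, k)] counts those where the distinguished U is in a
   mixed pair. *)
rewrite -!natrM -natrD; congr (_%:R); rewrite /wick_coef binS.
have -> : (b - k.+1 = b.-1 - k)%N by lia.
move: (k.+1)`! (factS k) => f hf.
rewrite mulnDr !mulnDl subSS; congr (_ + _)%N; last first.
  transitivity (k`! * 'C(a, k) * (b * 'C(b.-1, k)) * gauss_moment (a - k) *
    gauss_moment (b.-1 - k))%N; last by ring.
  by rewrite mul_bin_diag hf; ring.
have [ak|ak] := leqP k.+1 a; last first.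
  by rewrite (@bin_small a k.+1)// (@bin_small a.-1 k.+1) ?(muln0, mul0n)//; lia.
have -> : (a - k = (a - k.+1).+1)%N by lia.
rewrite gauss_momentS; have -> : ((a - k.+1).-1 = a.-1 - k.+1)%N by lia.
transitivity (f * (a * 'C(a.-1, k.+1)) * 'C(b, k.+1) * gauss_moment (a.-1 - k.+1) *
  gauss_moment (b.-1 - k))%N; last by ring.
by rewrite mul_bin_down; ring.
Qed.

Lemma wickSr a b : wick a b.+1 = b%:R *: wick a b.-1 + a%:R *: ('X * wick a.-1 b).
Proof. by rewrite wickC wickSl wickC (wickC b). Qed.

(** The derivative of E[f(U) g(V)] in the correlation is E[f'(U) g'(V)]; here it is checked on
    coefficients. *)
Lemma deriv_wick a b : (wick a b)^`() = (a * b)%:R *: wick a.-1 b.-1.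
Proof.
apply/polyP => k; rewrite coef_deriv coefZ !coef_wick -mulrnA -natrM; congr (_%:R).
rewrite /wick_coef factS; have := mul_bin_diag b k; have := mul_bin_diag a k.
have -> : (b - k.+1 = b.-1 - k)%N by lia.
have -> : (a - k.+1 = a.-1 - k)%N by lia.
move=> ha hb.
transitivity (k`! * (k.+1 * 'C(a, k.+1)) * (k.+1 * 'C(b, k.+1)) *
   gauss_moment (a.-1 - k) * gauss_moment (b.-1 - k))%N; first by ring.
by rewrite -ha -hb; ring.
Qed.

(** Trading one U for a V is a first-order differential operator in the correlation. Expanding the
    left side by [wickSr] and the last term by [wickSl], the contributions in ['X^2] cancel. *)
Lemma wick_transfer a b :
  a%:R *: wick a.-1 b.+1 = (1 - 'X^2) * (wick a b)^`() + a%:R *: ('X * wick a b).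
Proof.
case: a => [|a]; first by rewrite deriv_wick mul0n !scale0r mulr0 addr0.
rewrite deriv_wick /= wickSr wickSl -!mul_polyC !polyC_natr natrM.
by case: a => [|a]/=; ring.
Qed.

End WickPolynomials.

(** * Products of Wick polynomials over the columns *)

Section WickProducts.
Variables (R : comNzRingType) (T : finType).
Implicit Types (x y : T -> nat).

Definition wick_prod x y : {poly R} := \prod_j wick R (x j) (y j).

Lemma wick_prodC x y : wick_prod x y = wick_prod y x.
Proof. by apply: eq_bigr => j _; rewrite wickC. Qed.

Lemma wick_prodD1 x y x' y' k :
  {in predC1 k, x' =1 x} -> {in predC1 k, y' =1 y} ->
  wick_prod x' y' = wick R (x' k) (y' k) * \prod_(j | j != k) wick R (x j) (y j).
Proof.
move=> xx yy; rewrite /wick_prod (bigD1 k)//=; congr (_ * _).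
by apply: eq_bigr => j jk; rewrite xx// yy.
Qed.

Lemma incr_neq x k : {in predC1 k, incr x k =1 x}.
Proof. by move=> j /negPf; rewrite /incr /= => ->; rewrite addn0. Qed.

Lemma decr_neq x k : {in predC1 k, decr x k =1 x}.
Proof. by move=> j /negPf; rewrite /decr /= => ->; rewrite subn0. Qed.

Lemma incr_eq x k : incr x k k = (x k).+1.
Proof. by rewrite /incr eqxx addn1. Qed.

Lemma decr_eq x k : decr x k k = (x k).-1.
Proof. by rewrite /decr eqxx subn1. Qed.

Lemma wick_prod_incrl x y k : wick_prod (incr x k) y =
  (x k)%:R *: wick_prod (decr x k) y + (y k)%:R *: ('X * wick_prod x (decr y k)).
Proof.
rewrite (@wick_prodD1 x y (incr x k) y k)//; last exact: incr_neq.
rewrite (@wick_prodD1 x y (decr x k) y k)//; last exact: decr_neq.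
rewrite (@wick_prodD1 x y x (decr y k) k)//; last exact: decr_neq.
by rewrite incr_eq !decr_eq wickSl mulrDl -!scalerAl mulrA.
Qed.

Lemma wick_prod_incrr x y k : wick_prod x (incr y k) =
  (y k)%:R *: wick_prod x (decr y k) + (x k)%:R *: ('X * wick_prod (decr x k) y).
Proof. by rewrite wick_prodC wick_prod_incrl wick_prodC (wick_prodC y). Qed.

Lemma wick_prod_transfer x y :
  \sum_j (x j)%:R *: wick_prod (decr x j) (incr y j) =
  (1 - 'X^2) * (wick_prod x y)^`() + (\sum_j x j)%:R *: ('X * wick_prod x y).
Proof.
rewrite [in X in _ = X + _]/wick_prod deriv_prod ?index_enum_uniq//.
rewrite natr_sum scaler_suml big_distrr/= -big_split/=; apply: eq_bigr => j _.
rewrite (@wick_prodD1 x y (decr x j) (incr y j) j); [|exact: decr_neq|exact: incr_neq].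
rewrite (@wick_prodD1 x y x y j)// decr_eq incr_eq.
by rewrite scalerAl wick_transfer mulrDl -!scalerAl !mulrA.
Qed.

(** Each mixed pair uses two variables, so a factor has degree at most half its number of variables,
    and such bounds add up. The functional identities below assume this degree bound. *)
Lemma wick_prod_half_degree x y k :
  (\sum_j x j + \sum_j y j < k.*2)%N -> (wick_prod x y)`_k = 0.
Proof.
rewrite -big_split/= /wick_prod; elim: (index_enum T) k => [|j r IH] k.
  by rewrite !big_nil coef1; case: k.
rewrite !big_cons => hk; rewrite coefM big1// => i _.
have [hi|hi] := ltnP (x j + y j) i.*2.
  by rewrite coef_wick wick_coef_eq0// mul0r.
rewrite IH ?mulr0//; have := ltn_ord i; lia.
Qed.

Lemma wick_prod0l x y : (forall j, x j = 0%N) ->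
  wick_prod x y = (\prod_j gauss_moment (y j))%:R%:P.
Proof.
move=> x0; rewrite natr_prod rmorph_prod; apply: eq_bigr => j _.
by rewrite x0 wick0l.
Qed.

End WickProducts.

(** * The functional L_d and its two identities *)

Section WickFunctional.
Variable (R : realType) (m : nat).

(* Up to normalization, the moments of the imaginary variable 'X = i s, where s
   has density proportional to (1 + s^2)^-(1 + (d + m) / 2). *)
Definition wick_weight (d k : nat) : R :=
  if odd k then 0 else
  (-1) ^+ k./2 * (dfact k * dfact (d + m - k))%:R / (dfact (d + m).+1)%:R.

Lemma dfact_neq0 k : (dfact k)%:R != 0 :> R.
Proof. by rewrite pnatr_eq0 -lt0n dfact_gt0. Qed.

(** Integration by parts against the density behind [wick_weight], with 1 - X^2 = 1 + s^2, checked
    on monomials. The degree bound keeps the natural subtraction in [wick_weight] from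
    truncating. *)
Lemma wick_functional_deriv d (p : {poly R}) :
  (forall k, (d < k.*2)%N -> p`_k = 0) ->
  functional (wick_weight d) ((1 - 'X^2) * p^`()) =
  - ((d + m)%:R * functional (wick_weight d) ('X * p)).
Proof.
move=> hp; apply/eqP; rewrite -addr_eq0; apply/eqP.
have -> : (1 - 'X^2) * p^`() = p^`() - 'X * ('X * p^`()) by ring.
rewrite functionalB !functionalXM !functional_deriv /functional.
rewrite big_distrr/= -sumrB -big_split/= big1// => k _.
have [hk|hk] := ltnP d k.*2; first by rewrite hp// !mul0r; ring.
rewrite -mulrBr mulrCA -mulrDr [X in _ * X](_ : _ = 0) ?mulr0//.
case: k hk => -[|k] /= _ hk; first by rewrite /wick_weight/=; ring.
rewrite /wick_weight /= negbK; case: (boolP (odd k)) => ok; first by ring.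
have -> : (d + m - k = (d + m - k.+2).+2)%N by lia.
rewrite !dfactS exprS.
have -> : (d + m)%:R = (d + m - k.+2).+1%:R + k.+1%:R :> R.
  by rewrite -natrD; congr (_%:R); lia.
by rewrite !natrM; field; exact: dfact_neq0.
Qed.

(** Multiplying by 1 - X^2 = 1 + s^2 turns the density of index [d.+2] into that of index [d]; the
    denominator in [wick_weight] is the normalization that makes this exact. *)
Lemma wick_functional_shift d (p : {poly R}) :
  (forall k, (d < k.*2)%N -> p`_k = 0) ->
  functional (wick_weight d.+2) ((1 - 'X^2) * p) = functional (wick_weight d) p.
Proof.
move=> hp; have -> : (1 - 'X^2) * p = p - 'X * ('X * p) by ring.
rewrite functionalB !functionalXM /functional -sumrB; apply: eq_bigr => k _.
have [hk|hk] := ltnP d k.*2; first by rewrite hp// !mul0r subr0.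
rewrite -mulrBr; congr (_ * _); rewrite /wick_weight/= negbK.
case: ifP => ok; first by rewrite subr0.
have -> : (d.+2 + m - k = (d + m - k).+2)%N by lia.
have -> : (d.+2 + m - k.+2 = d + m - k)%N by lia.
rewrite addSn addSn !dfactS exprS !natrM.
have := dfact_neq0 (d + m).+1.
have : (d + m).+2%:R != 0 :> R by rewrite pnatr_eq0.
have -> : (d + m).+2%:R = (d + m - k).+1%:R + k.+1%:R :> R.
  by rewrite -natrD; congr (_%:R); lia.
by rewrite -!nat1r => h1 h2; field; rewrite h2 h1.
Qed.

End WickFunctional.

(** * The moment formula *)

Lemma exponents_neq0 (T : finType) (a : T -> nat) : (0 < \sum_j a j)%N ->
  exists k, (0 < a k)%N.
Proof.
move=> h; apply: contrapT => /forallNP a0; move: h; rewrite big1// => j _.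
by have := a0 j; case: (a j).
Qed.

Lemma exponents_eq0 (T : finType) (a : T -> nat) : (\sum_j a j)%N = 0%N ->
  a = (fun=> 0%N).
Proof.
move=> h; apply/funext => j; apply/eqP; rewrite -leqn0 -h.
by rewrite (bigD1 j)//= leq_addr.
Qed.

Section MomentFormula.
(* [m] is the [n - 2] of the informal statement. *)
Variables (R : realType) (m : nat).
Local Notation n := m.+2.
Variables (mu : probability (orthogonal_borel R n) R) (mu_haar : is_haar mu).
Variables (i0 i1 : 'I_n) (i01 : i0 != i1).
Implicit Types (x y : 'I_n -> nat).
Local Notation M := (moment2 mu i0 i1).
Local Notation sum x := (\sum_j x j)%N.

(** These are the moments of a uniform point of the sphere. When the other row is empty, integration
    by parts becomes a recursion lowering the degree by two. *)
Lemma sphere_moment y : (dfact (sum y + m).+1)%:R * M (fun=> 0%N) y =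
  (dfact m.+1 * \prod_j gauss_moment (y j))%:R.
Proof.
have [N] := ubnP (sum y); elim: N y => // N IH y hN.
have [y0|] := posnP (sum y).
  rewrite y0 (exponents_eq0 y0) moment2_0 mulr1 add0n big1 ?muln1// => j _.
  by rewrite /gauss_moment/= dfact0.
move=> /exponents_neq0[k yk]; rewrite -(decrK yk).
have hy : (sum (decr y k)).+1 = sum y := sum_decr yk.
move: (decr y k) {yk} hy => z hz.
(* The two rows trade places, since [moment2_by_parts] raises an exponent of its first row. *)
have := moment2_by_parts (mu := mu) mu_haar (i0 := i1) (i1 := i0).
rewrite eq_sym => /(_ i01 z (fun=> 0%N) k); rewrite [X in _ + X]big1 ?addr0; last first.
  by move=> j _; rewrite mul0r.
rewrite -!(moment2C _ _ _ i01) /= => E.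
rewrite sum_incr addSn dfactS natrM.
have -> : \prod_j gauss_moment (incr z k j) = (z k * \prod_j gauss_moment (decr z k j))%N.
  rewrite (bigD1 k)//= [in RHS](bigD1 k)//= incr_eq decr_eq gauss_momentS mulnA.
  congr (_ * _)%N; apply: eq_bigr => j jk.
  by rewrite (incr_neq z jk) (decr_neq z jk).
rewrite mulrAC [_%:R * M _ _](_ : _ = (z k)%:R * M (fun=> 0%N) (decr z k)); last first.
  rewrite -E; congr (_%:R * _); by rewrite addSn addnC.
have [->|zk] := posnP (z k); first by rewrite !mul0r mul0n muln0.
have hs : (sum (decr z k)).+1 = sum z := sum_decr zk.
rewrite mulnCA natrM -(IH (decr z k)); last lia.
by rewrite -hs !addSn; ring.
Qed.

(** Induction on the degree of the first row, which [moment2_by_parts_rotated] lowers by two. The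
    Wick side obeys the same recursion: [wick_prod_transfer] rewrites the sum over columns,
    [wick_functional_deriv] removes the derivative and [wick_functional_shift] adjusts the total
    degree. *)
Lemma moment2_formula x y :
  (dfact (sum x + m) * dfact (sum y + m))%:R * M x y =
  (dfact m * dfact m.+1)%:R *
  functional (wick_weight R m (sum x + sum y)) (wick_prod R x y).
Proof.
have [N] := ubnP (sum x); elim: N x y => // N IH x y hN.
have [x0|] := posnP (sum x).
  rewrite x0 add0n (exponents_eq0 x0) wick_prod0l// functionalC /wick_weight/=.
  rewrite expr0 mul1r dfact0 mul1n subn0.
  apply: (mulfI (dfact_neq0 R (sum y + m).+1)).
  rewrite mulrCA sphere_moment !natrM; field.
  exact: dfact_neq0.
move=> /exponents_neq0[k xk]; rewrite -(decrK xk).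
have hx : (sum (decr x k)).+1 = sum x := sum_decr xk.
move: (decr x k) {xk} hx => z hz.
(* Row sum one is settled by parity: the Wick product is a multiple of ['X] by a constant, and odd
   weights vanish. Afterwards [sum z + m] is positive. *)
have [z0|z0] := posnP (sum z).
  rewrite (moment2_odd mu_haar i01) ?mulr0; last by rewrite sum_incr z0.
  rewrite wick_prod_incrl (exponents_eq0 z0) scale0r add0r.
  rewrite (@wick_prod0l _ _ (fun=> 0%N) (decr y k))// functionalZ functionalXM functionalC.
  by rewrite /wick_weight/= !mulr0.
rewrite sum_incr !addSn.
pose c := wick_weight R m (sum z + sum y).+1.
pose K : R := (dfact m * dfact m.+1)%:R.
pose D : R := (dfact (sum z + m).-1 * dfact (sum y + m))%:R.
rewrite -/c -/K.
(* The total degree here is two below that of [incr z k] and [y], which costs a factor 1 - X^2 under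
   the common functional [c]. *)
have hM : (z k)%:R * (D * M (decr z k) y) =
    (z k)%:R * (K * functional c ((1 - 'X^2) * wick_prod R (decr z k) y)).
  have [->|zk] := posnP (z k); first by rewrite !mul0r.
  have hs : (sum (decr z k)).+1 = sum z := sum_decr zk; congr (_ * _).
  have -> : D = (dfact (sum (decr z k) + m) * dfact (sum y + m))%:R.
    by rewrite /D -hs addSn.
  rewrite IH; last by lia.
  congr (_ * _); rewrite /c -hs !addSn wick_functional_shift// => i hi.
  exact: wick_prod_half_degree.
(* Here the total degree is already that of [c]; the factor [(sum y + m).+1] comes from the second
   row sum growing by two. *)
have hT : \sum_j (z j)%:R * ((sum y + m).+1%:R * D * M (decr z j) (incr (incr y k) j)) =
    K * functional c (\sum_j (z j)%:R *: wick_prod R (decr z j) (incr (incr y k) j)).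
  rewrite functional_sum big_distrr/=; apply: eq_bigr => j _.
  have [->|zj] := posnP (z j); first by rewrite scale0r mul0r /functional size_poly0 big_ord0 mulr0.
  have hs : (sum (decr z j)).+1 = sum z := sum_decr zj.
  have -> : (sum y + m).+1%:R * D =
      (dfact (sum (decr z j) + m) * dfact (sum (incr (incr y k) j) + m))%:R.
    by rewrite /D -hs !sum_incr !addSn dfactS !natrM /=; ring.
  rewrite IH; last by lia.
  rewrite functionalZ mulrCA; congr (_ * (_ * functional (wick_weight _ _ _) _)).
  by rewrite !sum_incr; lia.
have -> : (dfact (sum z + m).+1 * dfact (sum y + m))%:R = (sum z + m)%:R * D.
  have e : (sum z + m = (sum z + m).-1.+1)%N by lia.
  by rewrite [in LHS]e dfactS -e /D !natrM; ring.
apply: (@mulfI _ (sum y + m).+1%:R); first by rewrite pnatr_eq0.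
have := moment2_by_parts_rotated mu_haar i01 z y k => /=.
have -> : (m.+1 + sum z)%:R = (sum z + m)%:R + 1 :> R.
  by rewrite natr1; congr (_%:R); lia.
move=> hP.
have {}hP : (sum z + m)%:R * M (incr z k) y = (z k)%:R * M (decr z k) y -
    \sum_j (z j)%:R * M (decr z j) (incr (incr y k) j) by rewrite -hP; ring.
transitivity ((sum y + m).+1%:R * ((z k)%:R * (D * M (decr z k) y)) -
   \sum_j (z j)%:R * ((sum y + m).+1%:R * D * M (decr z j) (incr (incr y k) j))).
  transitivity ((sum y + m).+1%:R * D * ((sum z + m)%:R * M (incr z k) y)); first by ring.
  rewrite hP mulrBr; congr (_ - _); first by ring.
  by rewrite big_distrr/=; apply: eq_bigr => j _; ring.
(* The transfer contributes [sum z] and the derivative minus [(sum z + sum y).+1 + m]; the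
   difference is minus the factor [(sum y + m).+1] common to all the other terms. *)
rewrite hM hT wick_prod_transfer functionalD functionalZ wick_functional_deriv; last first.
  by move=> i hi; apply: wick_prod_half_degree; rewrite sum_incr; lia.
rewrite -/c wick_prod_incrl (functionalD c) functionalZ.
have -> : (1 - 'X^2) * wick_prod R (decr z k) y =
    wick_prod R (decr z k) y - 'X * ('X * wick_prod R (decr z k) y) by ring.
have -> : 'X * wick_prod R z (incr y k) = (y k)%:R *: ('X * wick_prod R z (decr y k)) +
    (z k)%:R *: ('X * ('X * wick_prod R (decr z k) y)).
  by rewrite wick_prod_incrr mulrDr -!scalerAr.
rewrite functionalB (functionalD c) !functionalZ.
have -> : ((sum z + sum y).+1 + m)%:R = (sum z)%:R + (sum y + m).+1%:R :> R.
  by rewrite -natrD; congr (_%:R); lia.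
ring.
Qed.

End MomentFormula.

(** * Padding by zero columns, and the symmetry of F *)

Section Extension.
Variables (n q : nat) (hq : (q <= n)%N).

Definition extend (f : 'I_q -> nat) (j : 'I_n) : nat := oapp f 0%N (insub (val j)).

Lemma extend_widen f j : extend f (widen_ord hq j) = f j.
Proof. by rewrite /extend /= valK. Qed.

Lemma extend_out f (j : 'I_n) : (q <= j)%N -> extend f j = 0%N.
Proof. by move=> qj; rewrite /extend insubF// ltnNge qj. Qed.

Lemma big_extend (T : Type) (idx : T) (op : Monoid.law idx) (F : 'I_n -> T)
    (G : 'I_q -> T) :
  (forall j, F (widen_ord hq j) = G j) -> (forall j : 'I_n, (q <= j)%N -> F j = idx) ->
  \big[op/idx]_j F j = \big[op/idx]_j G j.
Proof.
move=> FG F1; transitivity (\big[op/idx]_(j < n | (j < q)%N) F j).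
  rewrite [RHS]big_mkcond; apply: eq_bigr => j _; case: ltnP => //; exact: F1.
rewrite (big_ord_narrow hq); exact: eq_bigr.
Qed.

End Extension.

(** The double factorials of the separate row sums in [F_int] are those of [moment2_formula], so the
    row sums enter only through their total [S]. *)
Lemma F_intE (R : realType) (m q : nat)
    (mu : probability (orthogonal_borel R m.+2) R) (mu_haar : is_haar mu)
    (h2 : (2 <= m.+2)%N) (hq : (q <= m.+2)%N) (z : 'M[nat]_(2, q)) :
  let S := (\sum_j (z 0%R j + z 1%R j))%N in
  F_int mu h2 hq z =
  (dfact m * dfact m.+1)%:R *
  functional (wick_weight R m S) (wick_prod R (z 0) (z 1)) /
  (dfact m * dfact (S + m))%:R *
  ((dfact (S + m).+1)%:R / (dfact m.+1 * \prod_j (dfact (z 0%R j) * dfact (z 1%R j)))%:R).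
Proof.
move=> S; have ord2 : lift ord0 ord0 = 1 :> 'I_2 by apply: val_inj.
pose i0 : 'I_m.+2 := widen_ord h2 0; pose i1 : 'I_m.+2 := widen_ord h2 1.
have i01 : i0 != i1 by [].
pose x := @extend m.+2 q (z 0); pose y := @extend m.+2 q (z 1).
have sx : (\sum_j x j = \sum_j z 0%R j)%N.
  by apply: big_extend => j; [exact: extend_widen | exact: extend_out].
have sy : (\sum_j y j = \sum_j z 1%R j)%N.
  by apply: big_extend => j; [exact: extend_widen | exact: extend_out].
have wxy : wick_prod R x y = wick_prod R (z 0) (z 1).
  apply: (big_extend (hq := hq)) => j; first by rewrite /x /y !extend_widen.
  by move=> qj; rewrite /x /y !extend_out// wick0l /gauss_moment/= dfact0.
have IE : I_int mu h2 hq z = moment2 mu i0 i1 x y.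
  apply: eq_Rintegral => u _; rewrite !big_ord_recl big_ord0 mulr1 ord2 /monomial.
  pose G r := \prod_j orthogonal_mx u r j ^+ two_rows i0 i1 x y (r, j).
  transitivity (\prod_r G r); last first.
    by rewrite pair_bigA/=; apply: eq_bigr => -[].
  rewrite (bigD1 i0)//= [in RHS](bigD1 i1)//= [X in _ = _ * (_ * X)]big1 ?mulr1; last first.
    move=> r /andP[r0 r1]; apply: big1 => j _.
    by rewrite two_rows_other.
  congr (_ * _); apply/esym; apply: (big_extend (hq := hq)) => j.
  - by rewrite two_rows_fst /x extend_widen.
  - by move=> qj; rewrite two_rows_fst /x extend_out.
  - by rewrite two_rows_snd// /y extend_widen.
  - by move=> qj; rewrite two_rows_snd// /y extend_out.
have XY : (\sum_j z 0%R j + \sum_j z 1%R j)%N = S by rewrite -big_split.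
have := moment2_formula mu_haar i01 x y; rewrite sx sy wxy XY => <-.
rewrite /F_int /J_int IE XY.
have -> : (\sum_(i < 2) \sum_(j < q) z i j)%N = S.
  by rewrite !big_ord_recl big_ord0 addn0 ord2 XY.
have -> : (\prod_(i < 2) \prod_(j < q) dfact (z i j) =
    \prod_j (dfact (z 0%R j) * dfact (z 1%R j)))%N.
  by rewrite !big_ord_recl big_ord0 muln1 ord2 -big_split.
rewrite !addnS !subSS !subn0 invf_div.
by rewrite mulrA; congr (_ * _); exact: mulrAC.
Qed.

(** Every ingredient of [F_intE] is a sum or product over columns of a symmetric expression in the
    two entries, so each column can be exchanged independently of the others. *)
Lemma F_int_swap_columns (R : realType) (n q : nat)
    (mu : probability (orthogonal_borel R n) R) (mu_haar : is_haar mu)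
    (h2 : (2 <= n)%N) (hq : (q <= n)%N) (z z' : 'M[nat]_(2, q)) :
  (forall j, (z' 0%R j = z 0%R j /\ z' 1%R j = z 1%R j) \/
             (z' 0%R j = z 1%R j /\ z' 1%R j = z 0%R j)) ->
  F_int mu h2 hq z = F_int mu h2 hq z'.
Proof.
case: n mu mu_haar h2 hq => [|[|m]] // mu mu_haar h2 hq swap.
rewrite !F_intE//.
have -> : (\sum_j (z' 0%R j + z' 1%R j) = \sum_j (z 0%R j + z 1%R j))%N.
  by apply: eq_bigr => j _; case: (swap j) => -[-> ->]; rewrite // addnC.
have -> : (\prod_j (dfact (z' 0%R j) * dfact (z' 1%R j)) =
    \prod_j (dfact (z 0%R j) * dfact (z 1%R j)))%N.
  by apply: eq_bigr => j _; case: (swap j) => -[-> ->]; rewrite // mulnC.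
have -> // : wick_prod R (z' 0) (z' 1) = wick_prod R (z 0) (z 1).
by apply: eq_bigr => j _; case: (swap j) => -[-> ->]; rewrite // wickC.
Qed.

Theorem theorem3p3 (R : realType) (n q s : nat)
    (mu : probability (orthogonal_borel R n) R) (mu_haar : is_haar mu)
    (h2 : (2 <= n)%N) (hqs : (q + s <= n)%N)
    (a b : 'rV[nat]_q) (c d : 'rV[nat]_s) :
  F_int mu h2 hqs (block_mx a c b d) = F_int mu h2 hqs (block_mx a d b c).
Proof.
apply: F_int_swap_columns mu_haar _ _ _ _ _ => j.
(* [block_mx] indexes the two rows by a sum 1 + 1; these identify its blocks with the rows 0 and 1
   used in [F_int]. *)
have row0 (A B : 'rV[nat]_(q + s)) k : col_mx A B 0 k = A 0 k.
  by rewrite -(col_mxEu A B 0 k); congr (col_mx A B _ k); exact: val_inj.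
have row1 (A B : 'rV[nat]_(q + s)) k : col_mx A B 1 k = B 0 k.
  by rewrite -(col_mxEd A B 0 k); congr (col_mx A B _ k); exact: val_inj.
rewrite /block_mx; case: (split_ordP j) => k ->.
  by left; rewrite !row0 !row1 !row_mxEl.
by right; rewrite !row0 !row1 !row_mxEr.
Qed.
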